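(* Let $X,\Sigma,A,T,f_\lambda$ be as in the context. Suppose that $x'=A(t)x$, $t\in\mathbb R$, admits an exponential dichotomy with constants $D,\rho>0$, and that there is $c\ge0$ such that $$|f_\lambda(t,x)-f_\lambda(t,y)|\le c|x-y|\quad\text{for all }t\in\mathbb R,\ \lambda\in\Sigma,\ x,y\in X.$$ Assume that $\tilde q:=\frac{2cD}{\rho}<1$. Given $\epsilon>0$, for each $\lambda\in\Sigma$ let $y_\lambda\colon\mathbb R\to X$ be a differentiable map satisfying $$|y_\lambda'(t)-A(t)y_\lambda(t)-f_\lambda(t,y_\lambda(t))|\le\epsilon\quad\text{for all }t\in\mathbb R.$$ Then, for each $\lambda\in\Sigma$, there exists a unique solution $x_\lambda\colon\mathbb R\to X$ of $x'=A(t)x+f_\lambda(t,x)$, $t\in\mathbb R$, such that $$\sup_{t\in\mathbb R}|x_\lambda(t)-y_\lambda(t)|\le\frac{\tilde L}{1-\tilde q},\qquad\text{where }\tilde L=\frac{2\epsilon D}{\rho}.$$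
   Context: $X=(X,|\cdot|)$ is an arbitrary Banach space; $\mathcal B(X)$ is the space of bounded linear operators on $X$ with operator norm $\|\cdot\|$. $\Sigma$ is an open subset of another Banach space. $A\colon\mathbb R\to\mathcal B(X)$ is continuous and $T(t,s)$, $t,s\in\mathbb R$, is the evolution family of $x'=A(t)x$ (so $x(t)=T(t,s)x(s)$ for every solution $x$). For each $\lambda\in\Sigma$, $f_\lambda\colon\mathbb R\times X\to X$ is continuous. The equation $x'=A(t)x$ admits an exponential dichotomy if there exist a family $P(t)$, $t\in\mathbb R$, of projections on $X$ and constants $D,\rho>0$ such that $T(t,s)P(s)=P(t)T(t,s)$ for all $t,s\in\mathbb R$ and $\|\mathcal G(t,s)\|\le De^{-\rho|t-s|}$ for all $t,s\in\mathbb R$, where $$\mathcal G(t,s)=\begin{cases}T(t,s)P(s)& t\ge s,\\ -T(t,s)(\mathrm{Id}-P(s))& t<s.\end{cases}$$ *)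

(* Defs.v *)
From Stdlib Require Import Reals.
From Coquelicot Require Import Coquelicot.

Local Open Scope R_scope.

(* Banach spaces are [CompleteNormedModule R_AbsRing]; a complex Banach space is
   covered through its underlying real structure, the time variable being real.
   Elements of B(X) are the maps X -> X satisfying Coquelicot's [is_linear],
   which includes boundedness. *)

Definition op_sub {X : NormedModule R_AbsRing} (L M : X -> X) (v : X) : X :=
  minus (L v) (M v).

(* Valued in [Rbar], so that an unbounded map has norm [p_infty]. *)
Definition op_norm {X : NormedModule R_AbsRing} (L : X -> X) : Rbar :=
  Lub_Rbar (fun r => exists v : X, norm v <= 1 /\ r = norm (L v)).

Definition op_continuous {X : NormedModule R_AbsRing} (A : R -> X -> X) : Prop :=
  forall (t : R) (eta : posreal),
    locally t (fun s => Rbar_lt (op_norm (op_sub (A s) (A t))) eta).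

Definition is_solution {X : NormedModule R_AbsRing} (F : R -> X -> X)
    (x : R -> X) : Prop :=
  forall t : R, is_derive x t (F t (x t)).

Record evolution_family {X : NormedModule R_AbsRing} (A : R -> X -> X)
    (T : R -> R -> X -> X) : Prop := {
  evolution_bounded : forall t s : R, is_linear (T t s);
  evolution_id : forall (s : R) (v : X), T s s v = v;
  evolution_solves : forall (s : R) (v : X), is_solution A (fun t => T t s v);
  evolution_transports : forall x : R -> X, is_solution A x ->
    forall t s : R, x t = T t s (x s)
}.

Definition is_projection {X : NormedModule R_AbsRing} (P : X -> X) : Prop :=
  is_linear P /\ forall v : X, P (P v) = P v.

Definition green {X : NormedModule R_AbsRing} (T : R -> R -> X -> X)
    (P : R -> X -> X) (t s : R) (v : X) : X :=
  if Rle_dec s t then T t s (P s v) else opp (T t s (minus v (P s v))).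

Definition exponential_dichotomy {X : NormedModule R_AbsRing}
    (T : R -> R -> X -> X) (D rho : R) : Prop :=
  0 < D /\ 0 < rho /\
  exists P : R -> X -> X,
    (forall t : R, is_projection (P t)) /\
    (forall (t s : R) (v : X), T t s (P s v) = P t (T t s v)) /\
    (forall t s : R,
       Rbar_le (op_norm (green T P t s)) (D * exp (- rho * Rabs (t - s)))).

Definition sup_dist {X : NormedModule R_AbsRing} (x y : R -> X) : Rbar :=
  Lub_Rbar (fun r => exists t : R, r = norm (minus (x t) (y t))).

(* Main.v *)
Require Import Defs.
From Stdlib Require Import Reals Lra Lia List
  IndefiniteDescription FunctionalExtensionality.
From Coquelicot Require Import Coquelicot.
Local Open Scope R_scope.

(* Since [y'] need not be continuous, the Green function cannot be integrated
   against the defect of [y].  Instead, for a continuous forcing [b] with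
   [|y' - A y - b| <= e], take any solution [u0] of [u' = A u + b] and pull
   [u0 - y] back to time 0.  The mean value inequality and the dichotomy bounds
   show that the stable part converges at minus infinity, the unstable part
   at plus infinity, and that subtracting from [u0] the orbit of [T] through the
   two limits brings it within [2 e D / rho] of [y].  Applied to
   [b t = f t (w t)], this makes the map sending [w] to the solution of
   [u' = A u + b] at bounded distance from [y] a contraction of ratio
   [2 c D / rho]. *)

(** * Deciding linear identities *)

(** Syntax for a reflective decision procedure. A difference has no constructor: it is quoted as a
    sum with an opposite. *)
Inductive vexp : Type :=
| Vvar (n : nat)
| Vzero
| Vplus (a b : vexp)
| Vopp (a : vexp)
| Vscal (r : R) (a : vexp).

Section Vexp.

Context {X : ModuleSpace R_AbsRing}.

Fixpoint veval (env : list X) (e : vexp) : X :=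
  match e with
  | Vvar n => nth n env zero
  | Vzero => zero
  | Vplus a b => plus (veval env a) (veval env b)
  | Vopp a => opp (veval env a)
  | Vscal r a => scal r (veval env a)
  end.

Fixpoint vcoef (e : vexp) (i : nat) : R :=
  match e with
  | Vvar n => if Nat.eqb n i then 1 else 0
  | Vzero => 0
  | Vplus a b => vcoef a i + vcoef b i
  | Vopp a => - vcoef a i
  | Vscal r a => r * vcoef a i
  end.

Fixpoint lin_comb (env : list X) (c : nat -> R) : X :=
  match env with
  | nil => zero
  | v :: l => plus (scal (c O) v) (lin_comb l (fun n => c (S n)))
  end.

Lemma lin_comb_plus (env : list X) (c d : nat -> R) :
  lin_comb env (fun n => c n + d n) = plus (lin_comb env c) (lin_comb env d).
Proof.
  revert c d. induction env as [|v l IH]; intros c d; simpl.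
  - now rewrite plus_zero_l.
  - rewrite (IH (fun n => c (S n)) (fun n => d (S n))).
    rewrite (scal_distr_r (c O) (d O) v : scal (c O + d O) v = _), <- !plus_assoc.
    f_equal.
    rewrite !plus_assoc. f_equal. apply plus_comm.
Qed.

Lemma lin_comb_scal (env : list X) (r : R) (c : nat -> R) :
  lin_comb env (fun n => r * c n) = scal r (lin_comb env c).
Proof.
  revert c. induction env as [|v l IH]; intros c; simpl.
  - symmetry. exact (scal_zero_r (r : R_AbsRing)).
  - rewrite (IH (fun n => c (S n))).
    rewrite <- (scal_assoc r (c O) v : _ = scal (r * c O) v).
    symmetry. exact (scal_distr_l r _ _).
Qed.

Lemma lin_comb_zero (env : list X) : lin_comb env (fun _ => 0) = zero.
Proof.
  induction env as [|v l IH]; simpl; [reflexivity|].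
  rewrite IH, plus_zero_r. exact (scal_zero_l v).
Qed.

Lemma lin_comb_var (env : list X) (n : nat) :
  lin_comb env (fun i => if Nat.eqb n i then 1 else 0) = nth n env zero.
Proof.
  revert n. induction env as [|v l IH]; intros [|n]; simpl; try reflexivity.
  - rewrite lin_comb_zero, plus_zero_r. exact (scal_one v).
  - rewrite IH. rewrite (scal_zero_l v : scal 0 v = zero). apply plus_zero_l.
Qed.

(** Soundness of the reflection: a vector identity reduces to one real identity per atom, which
    [ring] can settle. *)
Lemma veval_lin_comb (env : list X) (e : vexp) :
  veval env e = lin_comb env (vcoef e).
Proof.
  induction e as [n| |a IHa b IHb|a IHa|r a IHa]; simpl.
  - symmetry. apply lin_comb_var.
  - symmetry. apply lin_comb_zero.
  - now rewrite IHa, IHb, <- lin_comb_plus.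
  - rewrite IHa, <- (scal_opp_one (K := R_AbsRing)).
    change (opp one : R_AbsRing) with (- (1)).
    rewrite <- lin_comb_scal.
    (* The two coefficient functions agree only pointwise, so the combinations are compared by
       induction on the list. *)
    assert (H : forall l : list X, forall c : nat -> R,
      lin_comb l (fun n => - (1) * c n) = lin_comb l (fun n => - c n)).
    { induction l as [|v l IH]; intros c; simpl; [reflexivity|].
      rewrite (IH (fun n => c (S n))). do 2 f_equal. ring. }
    apply H.
  - now rewrite IHa, <- lin_comb_scal.
Qed.

Lemma lin_comb_step (r s : R) (v a b : X) :
  r = s -> a = b -> plus (scal r v) a = plus (scal s v) b.
Proof. now intros -> ->. Qed.

End Vexp.

Ltac vindex x l :=
  lazymatch l with
  | x :: _ => constr:(O)
  | _ :: ?l' => let n := vindex x l' in constr:(S n)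
  end.

(** When [t] is not yet in the list, [vindex] fails and the inner [match] falls through to the
    branch that adds a new atom. *)
Ltac vatoms t l :=
  lazymatch t with
  | @plus _ ?a ?b => let l := vatoms a l in vatoms b l
  | @minus _ ?a ?b => let l := vatoms a l in vatoms b l
  | @opp _ ?a => vatoms a l
  | @scal _ _ _ ?a => vatoms a l
  | @zero _ => l
  | _ => match l with
         | _ => let n := vindex t l in l
         | _ => constr:(t :: l)
         end
  end.

Ltac vquote t l :=
  lazymatch t with
  | @plus _ ?a ?b =>
      let a := vquote a l in let b := vquote b l in constr:(Vplus a b)
  | @minus _ ?a ?b =>
      let a := vquote a l in let b := vquote b l in constr:(Vplus a (Vopp b))
  | @opp _ ?a => let a := vquote a l in constr:(Vopp a)
  | @scal _ _ ?r ?a => let a := vquote a l in constr:(Vscal r a)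
  | @zero _ => constr:(Vzero)
  | _ => let n := vindex t l in constr:(Vvar n)
  end.

(* Quoting matches the operations up to their structure instance: the instances
   arising from distinct coercion paths are convertible but not syntactically
   equal, which defeats [rewrite]. *)
Ltac module_eq :=
  lazymatch goal with
  | |- @eq _ ?a ?b =>
      lazymatch goal with
      | X : NormedModule R_AbsRing |- _ => module_eq_at X a b
      | X : CompleteNormedModule R_AbsRing |- _ => module_eq_at X a b
      end
  end
with module_eq_at X a b :=
  let l := vatoms a constr:(@nil X) in
  let l := vatoms b l in
  let ea := vquote a l in
  let eb := vquote b l in
  change (veval l ea = veval l eb);
  rewrite (veval_lin_comb l ea), (veval_lin_comb l eb);
  cbn [lin_comb vcoef Nat.eqb];
  repeat (apply lin_comb_step; [ring|]); reflexivity.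

(** * Normed modules *)

Lemma minus_zero_eq {G : AbelianGroup} (a b : G) : minus a b = zero -> a = b.
Proof.
  intros H. apply (plus_reg_r (opp b)). now rewrite plus_opp_r.
Qed.

Section NormedModules.

Context {X : NormedModule R_AbsRing}.

(** The axiom [norm_scal] is only an inequality; the converse comes from applying it to [/ r] and
    [scal r v]. *)
Lemma norm_scal_R (r : R) (v : X) : norm (scal r v) = Rabs r * norm v.
Proof.
  apply Rle_antisym; [apply (norm_scal r v)|].
  destruct (Req_dec r 0) as [->|r0].
  { rewrite Rabs_R0, Rmult_0_l. apply norm_ge_0. }
  assert (H : norm v <= Rabs (/ r) * norm (scal r v)).
  { replace v with (scal (/ r) (scal r v)) at 1; [apply (norm_scal (/ r))|].
    rewrite scal_assoc. replace (mult (/ r) r) with (one : R_AbsRing).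
    - apply scal_one.
    - unfold one, mult; simpl. now field. }
  pose proof (Rabs_pos_lt r r0) as Hr.
  apply Rmult_le_compat_l with (r := Rabs r) in H; [|lra].
  rewrite Rabs_inv in H. rewrite <- Rmult_assoc, Rinv_r, Rmult_1_l in H; lra.
Qed.

Lemma norm_minus_sym (u v : X) : norm (minus u v) = norm (minus v u).
Proof. now rewrite <- (norm_opp (minus u v)), opp_minus. Qed.

Lemma norm_le_plus (w u v : X) : w = plus u v -> norm w <= norm u + norm v.
Proof. intros ->. apply norm_triangle. Qed.

Lemma norm_minus_self (v : X) : norm (minus v v) = 0.
Proof.
  replace (minus v v) with (zero : X) by module_eq. exact norm_zero.
Qed.

Lemma norm_minus_triangle (u v w : X) :
  norm (minus u w) <= norm (minus u v) + norm (minus v w).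
Proof.
  apply norm_le_plus. module_eq.
Qed.

Lemma norm_minus_le_sym (u v : X) (a : R) :
  norm (minus u v) <= a -> norm (minus v u) <= a.
Proof. now rewrite norm_minus_sym. Qed.

Lemma norm_minus_trans (u v w : X) (a b e : R) :
  norm (minus u v) <= a -> norm (minus v w) <= b -> a + b <= e ->
  norm (minus u w) <= e.
Proof. intros Ha Hb He. pose proof (norm_minus_triangle u v w). lra. Qed.

Lemma norm_le_eps (v w : X) :
  (forall e, 0 < e -> norm (minus v w) <= e) -> v = w.
Proof.
  intros H. apply minus_zero_eq, norm_eq_zero, Rle_antisym; [|apply norm_ge_0].
  apply le_epsilon. intros e He. specialize (H e He). lra.
Qed.

Lemma is_derive_norm (F : R -> X) (t : R) (l : X) :
  is_derive F t l <->
  forall e, 0 < e -> locally t (fun s =>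
    norm (minus (minus (F s) (F t)) (scal (s - t) l)) <= e * Rabs (s - t)).
Proof.
  split.
  - intros [_ H] e He.
    exact (H t (fun P HP => HP) (mkposreal e He)).
  - intros H. split; [apply is_linear_scal_l|].
    (* The only point to which [locally t] converges is [t]. *)
    intros x Hx. rewrite <- (is_filter_lim_locally_unique _ _ Hx).
    intros e. apply H, cond_pos.
Qed.

Lemma continuous_norm (F : R -> X) (t : R) :
  continuous F t <->
  forall e, 0 < e -> locally t (fun s => norm (minus (F s) (F t)) < e).
Proof.
  pose proof (filterlim_locally_ball_norm (F := locally t) F (F t)) as HF. split.
  - intros H e He. exact (proj1 HF H (mkposreal e He)).
  - intros H. apply (proj2 HF). intros e. apply H, cond_pos.
Qed.

Lemma is_derive_continuous (F : R -> X) (t : R) (l : X) :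
  is_derive F t l -> continuous F t.
Proof. intros H. apply ex_derive_continuous. now exists l. Qed.

(** Rescaling a nonzero [v] to norm one brings it into the ball over which [op_norm] takes its
    supremum. *)
Lemma op_norm_le (L : X -> X) (K : R) :
  is_linear L -> Rbar_le (op_norm L) K -> forall v, norm (L v) <= K * norm v.
Proof.
  intros HL HK v.
  assert (H : forall w, norm w <= 1 -> norm (L w) <= K).
  { intros w Hw.
    apply (Rbar_le_trans (norm (L w)) (op_norm L) K); [|exact HK].
    apply Lub_Rbar_correct. now exists w. }
  destruct (Req_dec (norm v) 0) as [v0|v0].
  - apply norm_eq_zero in v0. subst v.
    rewrite (linear_zero L HL), !norm_zero. lra.
  - pose proof (norm_ge_0 v).
    assert (Hv : 0 < / norm v) by (apply Rinv_0_lt_compat; lra).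
    specialize (H (scal (/ norm v) v)).
    rewrite (linear_scal L HL), !norm_scal_R, (Rabs_pos_eq (/ norm v)) in H
      by lra.
    rewrite Rinv_l in H by exact v0.
    apply Rmult_le_reg_l with (/ norm v); [exact Hv|].
    replace (/ norm v * (K * norm v)) with K by now field.
    apply H. lra.
Qed.

End NormedModules.

(** * Mean value inequality, and differentiation through families of linear maps *)

Section Mean_value.

Context {X : NormedModule R_AbsRing}.

(** The remainders of [F] and [phi] each contribute slope [e / 2]. In [mean_value_ineq] the
    left-sided bound reaches a supremum and the right-sided one passes beyond it. *)
Lemma derive_increment_bound (F : R -> X) (phi : R -> R) (s : R) (l : X) (m e : R) :
  is_derive F s l -> is_derive phi s m -> norm l <= m -> 0 < e ->
  exists d, 0 < d /\
    (forall u, s <= u < s + d ->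
       norm (minus (F u) (F s)) <= phi u - phi s + e * (u - s)) /\
    (forall u, s - d < u <= s ->
       norm (minus (F s) (F u)) <= phi s - phi u + e * (s - u)).
Proof.
  intros HF Hphi Hlm He.
  assert (He2 : 0 < e / 2) by lra.
  destruct (filter_and _ _ (proj1 (is_derive_norm _ _ _) HF _ He2)
    (proj1 (is_derive_norm _ _ _) Hphi _ He2)) as [d Hd].
  assert (H : forall u, Rabs (u - s) < d ->
    norm (minus (F u) (F s)) <= Rabs (u - s) * m + e / 2 * Rabs (u - s) /\
    Rabs (phi u - phi s - (u - s) * m) <= e / 2 * Rabs (u - s)).
  { intros u Hu. destruct (Hd u Hu) as [H1 H2]. split; [|exact H2].
    eapply Rle_trans;
      [apply (norm_le_plus _ (scal (u - s) l)
        (minus (minus (F u) (F s)) (scal (u - s) l))); module_eq|].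
    apply Rplus_le_compat; [|exact H1].
    rewrite norm_scal_R. apply Rmult_le_compat_l; [apply Rabs_pos|exact Hlm]. }
  exists d. split; [apply cond_pos|]. split; intros u Hu.
  - destruct (H u) as [H1 H2].
    { rewrite Rabs_pos_eq; lra. }
    rewrite (Rabs_pos_eq (u - s)) in H1, H2 by lra.
    apply Rabs_le_between in H2. lra.
  - destruct (H u) as [H1 H2].
    { rewrite Rabs_left1; lra. }
    rewrite (Rabs_left1 (u - s)) in H1, H2 by lra.
    apply Rabs_le_between in H2. rewrite norm_minus_sym. lra.
Qed.

(** Supremum argument: with an extra slope [e], the set of points where the bound from [a] holds
    contains its supremum [m], and could be extended past [m] if [m < b]. *)
Lemma mean_value_ineq (F F' : R -> X) (phi phi' : R -> R) (a b : R) :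
  a <= b ->
  (forall s, a <= s <= b -> is_derive F s (F' s)) ->
  (forall s, a <= s <= b -> is_derive phi s (phi' s)) ->
  (forall s, a <= s <= b -> norm (F' s) <= phi' s) ->
  norm (minus (F b) (F a)) <= phi b - phi a.
Proof.
  intros Hab HF Hphi Hle. apply le_epsilon. intros eps Heps.
  (* The [+ 1] keeps the denominator positive when [a = b]; over the whole interval the slack is at
     most [eps]. *)
  set (e := eps / (b - a + 1)).
  assert (He : 0 < e) by (apply Rdiv_lt_0_compat; lra).
  set (good := fun s => norm (minus (F s) (F a)) <= phi s - phi a + e * (s - a)).
  assert (Hgood : good b).
  2: { unfold good in Hgood. assert (e * (b - a) <= eps); [|lra].
       replace eps with (e * (b - a + 1)) by (unfold e; field; lra).
       apply Rmult_le_compat_l; lra. }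
  assert (chain : forall s u, good s ->
    norm (minus (F u) (F s)) <= phi u - phi s + e * (u - s) -> good u).
  { unfold good. intros s u H1 H2.
    pose proof (norm_minus_triangle (F u) (F s) (F a)). lra. }
  assert (good_a : good a).
  { unfold good. rewrite norm_minus_self. lra. }
  destruct (completeness (fun s => a <= s <= b /\ good s)) as [m [Hub Hlub]].
  { exists b. intros s [Hs _]. lra. }
  { exists a. split; [lra|exact good_a]. }
  assert (Hm : a <= m <= b).
  { split; [apply Hub; split; [lra|exact good_a]|].
    apply Hlub. intros s [Hs _]. lra. }
  destruct (derive_increment_bound F phi m (F' m) (phi' m) e (HF m Hm) (Hphi m Hm)
    (Hle m Hm) He) as (d & Hd & Hr & Hl).
  assert (good_m : good m).
  (* Either some good point lies within [d] to the left of [m], or [m - d] is a smaller upper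
     bound. *)
  { destruct (Classical_Prop.classic
      (exists s, m - d < s /\ a <= s <= b /\ good s)) as [(s & Hs & Hs')|Hno].
    - apply (chain s); [tauto|]. apply Hl. split; [exact Hs|]. now apply Hub.
    - exfalso. assert (m <= m - d); [|lra]. apply Hlub. intros s Hs.
      apply Rnot_lt_le. intros Hlt. apply Hno. now exists s. }
  destruct (Req_dec m b) as [<-|mb]; [exact good_m|].
  set (u := Rmin b (m + d / 2)).
  assert (Hu : m < u /\ u <= b /\ u < m + d).
  { unfold u, Rmin. destruct (Rle_dec b (m + d / 2)); lra. }
  assert (u <= m); [|lra].
  apply Hub. split; [lra|]. apply (chain m); [exact good_m|]. apply Hr. lra.
Qed.

(** Because [z] vanishes at [s0], no derivative of [L] enters: [L s (z s)] is [(s - s0) L s l] plus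
    [L s] of a remainder, controlled by strong continuity and by the local bound [K]
    respectively. *)
Lemma is_derive_linear_comp (L : R -> X -> X) (z : R -> X) (s0 K : R) (l : X) :
  (forall s, is_linear (L s)) -> 0 <= K ->
  locally s0 (fun s => forall v, norm (L s v) <= K * norm v) ->
  continuous (fun s => L s l) s0 ->
  z s0 = zero -> is_derive z s0 l ->
  is_derive (fun s => L s (z s)) s0 (L s0 l).
Proof.
  intros HL HK Hloc Hcont z0 Hz. apply is_derive_norm. intros e He.
  assert (He2 : 0 < e / 2) by lra.
  assert (HeK : 0 < e / 2 / (K + 1)) by (apply Rdiv_lt_0_compat; lra).
  generalize (filter_and _ _ Hloc (filter_and _ _
    (proj1 (continuous_norm _ _) Hcont _ He2)
    (proj1 (is_derive_norm _ _ _) Hz _ HeK))).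
  apply filter_imp. intros s (H1 & H2 & H3).
  rewrite z0, (linear_zero (L s0) (HL s0)).
  rewrite z0 in H3.
  set (r := minus (minus (z s) zero) (scal (s - s0) l)) in H3.
  replace (z s) with (plus r (scal (s - s0) l)) by (unfold r; module_eq).
  rewrite (linear_plus _ (HL s)), (linear_scal _ (HL s)).
  eapply Rle_trans;
    [apply (norm_le_plus _ (L s r) (scal (s - s0) (minus (L s l) (L s0 l))));
     module_eq|].
  rewrite norm_scal_R.
  pose proof (Rabs_pos (s - s0)) as Hp.
  assert (norm (L s r) <= e / 2 * Rabs (s - s0)).
  { eapply Rle_trans; [apply H1|].
    apply Rle_trans with ((K + 1) * (e / 2 / (K + 1) * Rabs (s - s0))).
    - apply Rmult_le_compat; [lra|apply norm_ge_0|lra|exact H3].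
    - right. field. lra. }
  assert (Rabs (s - s0) * norm (minus (L s l) (L s0 l)) <= Rabs (s - s0) * (e / 2)).
  { apply Rmult_le_compat_l; lra. }
  lra.
Qed.
Lemma is_linear_minus (l1 l2 : X -> X) :
  is_linear l1 -> is_linear l2 -> is_linear (fun v => minus (l1 v) (l2 v)).
Proof.
  intros H1 H2.
  apply (is_linear_comp (fun v => (l1 v, opp (l2 v)))
    (fun p : X * X => plus (fst p) (snd p))).
  - apply is_linear_prod; [exact H1|].
    apply (is_linear_comp l2 opp H2), is_linear_opp.
  - apply is_linear_plus.
Qed.

(** Insert [L s (b s0)]: the bound [K] handles the change of [b], strong continuity the change of
    [L]. *)
Lemma continuous_linear_comp (L : R -> X -> X) (b : R -> X) (s0 K : R) :
  (forall s, is_linear (L s)) -> 0 <= K ->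
  locally s0 (fun s => forall v, norm (L s v) <= K * norm v) ->
  continuous (fun s => L s (b s0)) s0 -> continuous b s0 ->
  continuous (fun s => L s (b s)) s0.
Proof.
  intros HL HK Hloc Hcont Hb. apply continuous_norm. intros e He.
  assert (He2 : 0 < e / 2) by lra.
  assert (HeK : 0 < e / 2 / (K + 1)) by (apply Rdiv_lt_0_compat; lra).
  generalize (filter_and _ _ Hloc (filter_and _ _
    (proj1 (continuous_norm _ _) Hcont _ He2)
    (proj1 (continuous_norm _ _) Hb _ HeK))).
  apply filter_imp. intros s (H1 & H2 & H3).
  eapply Rle_lt_trans; [apply (norm_minus_triangle _ (L s (b s0)))|].
  rewrite <- linear_minus by apply HL.
  assert (norm (L s (minus (b s) (b s0))) <= e / 2); [|lra].
  eapply Rle_trans; [apply H1|].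
  apply Rle_trans with ((K + 1) * (e / 2 / (K + 1))).
  - apply Rmult_le_compat; [lra|apply norm_ge_0|lra|now apply Rlt_le].
  - right. field. lra.
Qed.

Lemma mean_value_bound (F F' : R -> X) (a b C : R) :
  (forall s, a <= s <= b -> is_derive F s (F' s)) ->
  (forall s, a <= s <= b -> norm (F' s) <= C) ->
  forall s t, a <= s <= b -> a <= t <= b ->
  norm (minus (F t) (F s)) <= C * Rabs (t - s).
Proof.
  intros HF HC.
  assert (H : forall s t, a <= s <= b -> a <= t <= b -> s <= t ->
    norm (minus (F t) (F s)) <= C * (t - s)).
  { intros s t Hs Ht Hst.
    replace (C * (t - s)) with (C * t - C * s) by ring.
    apply (mean_value_ineq F F' (fun u => C * u) (fun _ => C) s t Hst).
    - intros u Hu. apply HF. lra.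
    - intros u _. auto_derive; [exact I|ring].
    - intros u Hu. apply HC. lra. }
  intros s t Hs Ht. destruct (Rle_lt_dec s t).
  - rewrite Rabs_pos_eq by lra. now apply H.
  - rewrite Rabs_left, norm_minus_sym by lra.
    replace (- (t - s)) with (s - t) by ring. apply H; lra.
Qed.

Lemma is_derive_linear (L : X -> X) (F : R -> X) (s : R) (l : X) :
  is_linear L -> is_derive F s l -> is_derive (fun u => L (F u)) s (L l).
Proof.
  intros HL HF.
  apply (filterdiff_ext_lin _ (fun r : R => L (scal r l))).
  - exact (filterdiff_comp' F L s _ L HF (filterdiff_linear L HL)).
  - intros r. exact (linear_scal L HL r l).
Qed.

End Mean_value.

(** * Evolution families *)

Section Evolution.

Context {X : CompleteNormedModule R_AbsRing}.
Variables (A : R -> X -> X) (T : R -> R -> X -> X).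
Hypothesis A_bounded : forall t, is_linear (A t).
Hypothesis A_cont : op_continuous A.
Hypothesis T_evol : evolution_family A T.

Let T_linear : forall t s, is_linear (T t s) := evolution_bounded A T T_evol.

Lemma generator_locally_bounded (t : R) :
  exists M, 0 < M /\ locally t (fun s => forall v, norm (A s v) <= M * norm v).
Proof.
  destruct (linear_norm _ (A_bounded t)) as (M & HM & HA).
  exists (1 + M). split; [lra|].
  generalize (A_cont t (mkposreal 1 Rlt_0_1)). apply filter_imp. intros s Hs v.
  apply Rbar_lt_le in Hs.
  pose proof (op_norm_le _ _ (is_linear_minus _ _ (A_bounded s) (A_bounded t)) Hs v)
    as H.
  change (norm (minus (A s v) (A t v)) <= 1 * norm v) in H. pose proof (HA v).
  pose proof (norm_le_plus (A s v) (minus (A s v) (A t v)) (A t v)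
    ltac:(module_eq)). lra.
Qed.

(** The orbit of [v] started at time [r] is itself a solution, hence is transported from [s] to
    [t]. *)
Lemma evolution_comp (t s r : R) (v : X) : T t s (T s r v) = T t r v.
Proof.
  symmetry.
  apply (evolution_transports A T T_evol (fun t => T t r v)).
  apply (evolution_solves A T T_evol).
Qed.

Lemma evolution_continuous (s t : R) (v : X) : continuous (fun t => T t s v) t.
Proof.
  exact (is_derive_continuous _ t _ (evolution_solves A T T_evol s v t)).
Qed.

(** Absorption argument: if [m] is the maximal norm of the orbit on an interval of length [2 h], the
    mean value inequality gives [m <= norm v + 2 h M m], and [h <= 1 / (4 M)] makes the last term at
    most [m / 2]. *)
Lemma evolution_near_diagonal (s0 : R) :
  exists h, 0 < h /\ forall s t v, Rabs (s - s0) < h -> Rabs (t - s0) < h ->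
    norm (T t s v) <= 2 * norm v.
Proof.
  destruct (generator_locally_bounded s0) as (M & HM & [d Hd]).
  (* Halving [d] keeps the closed interval of radius [h] inside the open neighbourhood where [M]
     bounds [A]. *)
  set (h := Rmin (d / 2) (/ (4 * M))).
  assert (Hh : 0 < h /\ h <= d / 2 /\ h <= / (4 * M)).
  { pose proof (cond_pos d). unfold h. split; [|split].
    - apply Rmin_pos; [lra|]. apply Rinv_0_lt_compat. lra.
    - apply Rmin_l.
    - apply Rmin_r. }
  exists h. split; [tauto|]. intros s t v Hs Ht.
  apply Rabs_def2 in Hs, Ht.
  set (x := fun u => T u s v).
  destruct (continuity_ab_maj (fun u => norm (x u)) (s0 - h) (s0 + h))
    as (u0 & Hmax & Hu0).
  { lra. }
  { intros u _. apply continuity_pt_filterlim.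
    exact (filterlim_comp _ _ _ x norm _ _ _
      (evolution_continuous s u v) (filterlim_norm (x u))). }
  set (m := norm (x u0)) in Hmax.
  assert (Hinc : forall u, s0 - h <= u <= s0 + h ->
    norm (minus (x u) (x s)) <= (M * m) * Rabs (u - s)).
  { intros u Hu.
    apply (mean_value_bound x (fun u => A u (x u)) (s0 - h) (s0 + h)); [| |lra|lra].
    - intros w _. apply (evolution_solves A T T_evol).
    - intros w Hw. eapply Rle_trans.
      + apply Hd. apply Rabs_def1; unfold minus, plus, opp; simpl; lra.
      + apply Rmult_le_compat_l; [lra|]. now apply Hmax. }
  assert (Hm : m <= norm v + m / 2).
  { specialize (Hinc u0 Hu0).
    assert (M * m * Rabs (u0 - s) <= m / 2).
    { replace (m / 2) with (M * m * (2 * / (4 * M))) by (field; lra).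
      apply Rmult_le_compat_l.
      - apply Rmult_le_pos; [lra|apply norm_ge_0].
      - apply Rabs_le. lra. }
    replace v with (x s) by apply (evolution_id A T T_evol).
    pose proof (norm_le_plus (x u0) (x s) (minus (x u0) (x s)) ltac:(module_eq)).
    fold m in H0. lra. }
  specialize (Hmax t). change (norm (x t) <= 2 * norm v). lra.
Qed.

(** Factor [T r s] through [s0]: the factor depending on [s] is then near the diagonal. *)
Lemma evolution_bound_source (r s0 : R) :
  exists K, 0 <= K /\ locally s0 (fun s => forall v, norm (T r s v) <= K * norm v).
Proof.
  destruct (evolution_near_diagonal s0) as (h & Hh & H).
  destruct (linear_norm _ (T_linear r s0)) as (K & HK & HT).
  exists (K * 2). split; [lra|]. exists (mkposreal h Hh). intros s Hs v.
  rewrite <- (evolution_comp r s0 s). eapply Rle_trans; [apply HT|].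
  rewrite Rmult_assoc. apply Rmult_le_compat_l; [lra|].
  apply H; [exact Hs|]. now rewrite Rminus_diag, Rabs_R0.
Qed.

Lemma evolution_bound_target (r s0 : R) :
  exists K, 0 <= K /\ locally s0 (fun s => forall v, norm (T s r v) <= K * norm v).
Proof.
  destruct (evolution_near_diagonal s0) as (h & Hh & H).
  destruct (linear_norm _ (T_linear s0 r)) as (K & HK & HT).
  exists (2 * K). split; [lra|]. exists (mkposreal h Hh). intros s Hs v.
  rewrite <- (evolution_comp s s0 r). eapply Rle_trans.
  - apply H; [now rewrite Rminus_diag, Rabs_R0|exact Hs].
  - rewrite Rmult_assoc. apply Rmult_le_compat_l; [lra|]. apply HT.
Qed.

(** The differential equation concerns the first time argument only. For the second, write
    [T r s v - T r s0 v] as [T r s (v - T s s0 v)]: locally bounded operators applied to a vector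
    tending to zero. *)
Lemma evolution_continuous_source (r s0 : R) (v : X) :
  continuous (fun s => T r s v) s0.
Proof.
  destruct (evolution_bound_source r s0) as (K & HK & Hloc).
  apply (continuous_norm (X := X)). intros e He.
  assert (HeK : 0 < e / (K + 1)) by (apply Rdiv_lt_0_compat; lra).
  generalize (filter_and _ _ Hloc
    (proj1 (continuous_norm (X := X) _ _) (evolution_continuous s0 s0 v) _ HeK)).
  apply filter_imp. intros s [H1 H2].
  rewrite (evolution_id A T T_evol) in H2.
  rewrite <- (evolution_comp r s s0 v), <- linear_minus by apply T_linear.
  rewrite norm_minus_sym in H2.
  apply Rle_lt_trans with (K * norm (minus v (T s s0 v))); [apply H1|].
  apply Rle_lt_trans with ((K + 1) * norm (minus v (T s s0 v))).
  - apply Rmult_le_compat_r; [apply norm_ge_0|lra].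
  - replace e with ((K + 1) * (e / (K + 1))) by (field; lra).
    apply Rmult_lt_compat_l; [lra|exact H2].
Qed.

(** Subtracting from [z] the orbit through [z t] changes the pullback by a constant only, and leaves
    a curve [zeta] vanishing at [t], to which [is_derive_linear_comp] applies. *)
Lemma evolution_pullback_derive (r t : R) (z : R -> X) (l : X) :
  is_derive z t l ->
  is_derive (fun s => T r s (z s)) t (T r t (minus l (A t (z t)))).
Proof.
  intros Hz. destruct (evolution_bound_source r t) as (K & HK & Hloc).
  set (zeta := fun s => minus (z s) (T s t (z t))).
  apply (is_derive_ext (fun s => plus (T r s (zeta s)) (T r t (z t)))).
  { intros s. unfold zeta.
    rewrite (linear_minus (T r s) _ _ (T_linear r s)).
    rewrite evolution_comp. module_eq. }
  replace (T r t (minus l (A t (z t))))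
    with (plus (T r t (minus l (A t (z t)))) (zero : X)) by module_eq.
  apply (is_derive_plus (V := X)); [|apply (is_derive_const (V := X))].
  apply (is_derive_linear_comp (fun s => T r s) zeta t K _ (T_linear r) HK Hloc).
  - apply evolution_continuous_source.
  - unfold zeta. rewrite (evolution_id A T T_evol). module_eq.
  - apply (is_derive_minus (V := X)); [exact Hz|].
    pose proof (evolution_solves A T T_evol t (z t) t) as H. cbv beta in H.
    rewrite (evolution_id A T T_evol) in H. exact H.
Qed.

(** Variation of constants: [u t] is [T t 0] applied to the integral of [T 0 s (b s)] over [s] from
    [0] to [t]. *)
Lemma inhomogeneous_solution (b : R -> X) :
  (forall t, continuous b t) ->
  exists u, is_solution (fun t v => plus (A t v) (b t)) u.
Proof.
  intros Hb. set (g := fun s => T 0 s (b s)).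
  assert (Hg : forall s, continuous g s).
  { intros s. destruct (evolution_bound_source 0 s) as (K & HK & Hloc).
    apply (continuous_linear_comp (fun s => T 0 s) b s K (T_linear 0) HK Hloc);
      [apply evolution_continuous_source|apply Hb]. }
  set (V := fun t => RInt g 0 t).
  assert (HV : forall t, is_derive V t (g t)).
  { intros t. apply (is_derive_RInt g V 0 t); [|apply Hg].
    apply filter_forall. intros s. apply (RInt_correct (V := X)).
    apply ex_RInt_continuous. intros; apply Hg. }
  exists (fun t => T t 0 (V t)). intros t.
  destruct (evolution_bound_target 0 t) as (K & HK & Hloc).
  (* The first summand is an orbit and yields [A]; the second has an argument vanishing at [t] and
     yields [b t]. *)
  apply (is_derive_ext (fun s => plus (T s 0 (V t)) (T s 0 (minus (V s) (V t))))).
  { intros s. rewrite (linear_minus (T s 0) _ _ (T_linear s 0)). module_eq. }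
  apply (is_derive_plus (V := X)); [apply (evolution_solves A T T_evol)|].
  replace (b t) with (T t 0 (g t)).
  2: { unfold g. now rewrite evolution_comp, (evolution_id A T T_evol). }
  apply (is_derive_linear_comp (fun s => T s 0) (fun s => minus (V s) (V t)) t K);
    [intros; apply T_linear|exact HK|exact Hloc|apply evolution_continuous|module_eq|].
  replace (g t) with (minus (g t) (zero : X)) by module_eq.
  apply (is_derive_minus (V := X)); [apply HV|apply (is_derive_const (V := X))].
Qed.

End Evolution.

(** * Exponential dichotomies *)

Lemma exp_monotone (x y : R) : x <= y -> exp x <= exp y.
Proof. intros [H| ->]; [left; now apply exp_increasing|apply Rle_refl]. Qed.

Lemma exp_decay_small (rho C e : R) :
  0 < rho -> 0 <= C -> 0 < e -> exists a, forall s, s <= a -> C * exp (rho * s) < e.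
Proof.
  (* Using [C + 1] covers [C = 0] and makes the final inequality strict. *)
  intros Hrho HC He. exists (ln (e / (C + 1)) / rho). intros s Hs.
  assert (HeC : 0 < e / (C + 1)) by (apply Rdiv_lt_0_compat; lra).
  assert (Hexp : exp (rho * s) <= e / (C + 1)).
  { rewrite <- (exp_ln (e / (C + 1)) HeC). apply exp_monotone.
    apply Rmult_le_compat_l with (r := rho) in Hs; [|lra].
    replace (rho * (ln (e / (C + 1)) / rho)) with (ln (e / (C + 1))) in Hs
      by (field; lra).
    exact Hs. }
  pose proof (exp_pos (rho * s)).
  apply Rlt_le_trans with ((C + 1) * exp (rho * s)); [lra|].
  replace e with ((C + 1) * (e / (C + 1))) by (field; lra).
  apply Rmult_le_compat_l; lra.
Qed.

(** * Limits at infinity of curves with exponentially decaying derivative *)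

Section Tail.

Context {X : CompleteNormedModule R_AbsRing}.

(** Comparing [S t (F u)] with the primitive [K / rho * exp (- rho * (t - u))] bounds its
    increments. At [t = 0], where [S] is the identity, this is a Cauchy criterion at minus infinity;
    for general [t], letting the lower end tend there gives the estimate. *)
Lemma backward_limit_bound (S : R -> X -> X) (F F' : R -> X) (K rho : R) :
  0 <= K -> 0 < rho ->
  (forall t, is_linear (S t)) -> (forall v, S 0 v = v) ->
  (forall s, is_derive F s (F' s)) ->
  (forall t s, s <= t -> norm (S t (F' s)) <= K * exp (- rho * (t - s))) ->
  exists p, forall t, norm (S t (minus (F t) p)) <= K / rho.
Proof.
  intros HK Hrho HS HS0 HF HF'.
  assert (HKrho : 0 <= K / rho).
  { apply Rmult_le_pos; [exact HK|]. apply Rlt_le, Rinv_0_lt_compat, Hrho. }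
  assert (Hinc : forall t s r, s <= r <= t ->
    norm (S t (minus (F r) (F s))) <= K / rho * exp (- rho * (t - r))).
  { intros t s r Hsr. rewrite (linear_minus (S t) _ _ (HS t)).
    apply Rle_trans with
      (K / rho * exp (- rho * (t - r)) - K / rho * exp (- rho * (t - s))).
    - apply (mean_value_ineq (X := X) (fun u => S t (F u)) (fun u => S t (F' u))
        (fun u => K / rho * exp (- rho * (t - u)))
        (fun u => K * exp (- rho * (t - u)))).
      + lra.
      + intros u _. exact (is_derive_linear (X := X) (S t) F u _ (HS t) (HF u)).
      + intros u _. auto_derive; [exact I|].
        unfold Rminus. field. lra.
      + intros u Hu. apply HF'. lra.
    - pose proof (exp_pos (- rho * (t - s))).
      assert (0 <= K / rho * exp (- rho * (t - s))) by (apply Rmult_le_pos; lra).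
      lra. }
  assert (Hlim : exists p : X, filterlim F (Rbar_locally m_infty) (locally p)).
  { apply (filterlim_locally_cauchy (U := X)). intros e.
    destruct (exp_decay_small rho (K / rho) e Hrho HKrho (cond_pos e)) as [a Ha].
    (* The increment bound at time [0] applies only to nonpositive arguments. *)
    set (a0 := Rmin a 0).
    exists (fun s => s < a0). split; [now exists a0|].
    assert (Hlt : forall r s, r < a0 -> s <= r -> norm (minus (F r) (F s)) < e).
    { intros r s Hr Hs.
      pose proof (Rmin_l a 0). pose proof (Rmin_r a 0). fold a0 in H, H0.
      rewrite <- (HS0 (minus (F r) (F s))).
      eapply Rle_lt_trans; [apply Hinc; lra|].
      replace (- rho * (0 - r)) with (rho * r) by ring. apply Ha. lra. }
    intros u v Hu Hv. apply (norm_compat1 (V := X)).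
    destruct (Rle_lt_dec u v).
    - now apply Hlt.
    - rewrite norm_minus_sym. apply Hlt; [exact Hu|lra]. }
  destruct Hlim as [p Hp]. exists p. intros t. apply le_epsilon. intros e He.
  destruct (linear_norm (S t) (HS t)) as (M & HM & HSM).
  assert (HeM : 0 < e / M) by (apply Rdiv_lt_0_compat; lra).
  pose proof (proj1 (filterlim_locally_ball_norm (U := X) F p) Hp
    (mkposreal _ HeM)) as [a Ha].
  set (s := Rmin t (a - 1)).
  assert (Hs : s <= t /\ s < a).
  { pose proof (Rmin_l t (a - 1)). pose proof (Rmin_r t (a - 1)). fold s in H, H0.
    lra. }
  specialize (Ha s (proj2 Hs)).
  change (norm (minus (F s) p) < e / M) in Ha.
  eapply Rle_trans;
    [apply (norm_le_plus (X := X) _ (S t (minus (F t) (F s))) (S t (minus (F s) p)))|].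
  { rewrite !(linear_minus (S t) _ _ (HS t)). module_eq. }
  apply Rplus_le_compat.
  - eapply Rle_trans; [apply Hinc; lra|].
    rewrite <- (Rmult_1_r (K / rho)) at 2. apply Rmult_le_compat_l; [exact HKrho|].
    rewrite <- exp_0. apply exp_monotone.
    assert (0 <= rho * (t - t)) by (apply Rmult_le_pos; lra). lra.
  - eapply Rle_trans; [apply HSM|].
    replace e with (M * (e / M)) by (field; lra).
    apply Rmult_le_compat_l; lra.
Qed.

(** Time reversal of [backward_limit_bound]; the factor [- 1] from the chain rule disappears in the
    norm. *)
Lemma forward_limit_bound (S : R -> X -> X) (F F' : R -> X) (K rho : R) :
  0 <= K -> 0 < rho ->
  (forall t, is_linear (S t)) -> (forall v, S 0 v = v) ->
  (forall s, is_derive F s (F' s)) ->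
  (forall t s, t <= s -> norm (S t (F' s)) <= K * exp (- rho * (s - t))) ->
  exists p, forall t, norm (S t (minus (F t) p)) <= K / rho.
Proof.
  intros HK Hrho HS HS0 HF HF'.
  destruct (backward_limit_bound (fun t => S (- t)) (fun s => F (- s))
    (fun s => scal (- 1) (F' (- s))) K rho) as [p Hp].
  - exact HK.
  - exact Hrho.
  - intros t. apply HS.
  - intros v. now rewrite Ropp_0.
  - intros s. apply (is_derive_comp (V := X) F Ropp s _ (- 1) (HF (- s))).
    auto_derive; [exact I|ring].
  - intros t s Hst.
    rewrite (linear_scal (S (- t)) (HS (- t))), (norm_scal_R (X := X)).
    replace (Rabs (- 1)) with 1 by (rewrite Rabs_left; lra).
    rewrite Rmult_1_l.
    replace (t - s) with (- s - - t) by ring. apply HF'. lra.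
  - exists p. intros t. specialize (Hp (- t)). now rewrite Ropp_involutive in Hp.
Qed.

End Tail.

(** * Splitting, shadowing and uniqueness for the linear equation *)

Section Dichotomy.

Context {X : CompleteNormedModule R_AbsRing}.
Variables (A : R -> X -> X) (T : R -> R -> X -> X).
Hypothesis A_bounded : forall t, is_linear (A t).
Hypothesis A_cont : op_continuous A.
Hypothesis T_evol : evolution_family A T.
Variables (D rho : R).
Hypothesis dich : exponential_dichotomy T D rho.

Let T_linear : forall t s, is_linear (T t s) := evolution_bounded A T T_evol.

(** Linearity of the Green operators turns the bounds on their norms into bounds on vectors, one for
    each branch. *)
Lemma dichotomy_split :
  exists P : R -> X -> X,
    (forall t, is_linear (P t)) /\
    (forall t s v, T t s (P s v) = P t (T t s v)) /\
    (forall t s (v : X), s <= t ->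
       norm (T t s (P s v)) <= D * exp (- rho * (t - s)) * norm v) /\
    (forall t s (v : X), t <= s ->
       norm (T t s (minus v (P s v))) <= D * exp (- rho * (s - t)) * norm v).
Proof.
  destruct dich as (HD & Hrho & P & HP & HPT & Hgreen).
  assert (P_linear : forall t, is_linear (P t)) by (intros t; apply HP).
  assert (Q_linear : forall t, is_linear (fun v => minus v (P t v))).
  { intros t. apply is_linear_minus; [apply is_linear_id|apply P_linear]. }
  assert (G_linear : forall t s, is_linear (green T P t s)).
  { intros t s. unfold green. destruct (Rle_dec s t).
    - exact (is_linear_comp (P s) (T t s) (P_linear s) (T_linear t s)).
    - apply (is_linear_comp (fun v => T t s (minus v (P s v))) opp);
        [|apply is_linear_opp].
      exact (is_linear_comp _ (T t s) (Q_linear s) (T_linear t s)). }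
  assert (HG : forall t s v,
    norm (green T P t s v) <= D * exp (- rho * Rabs (t - s)) * norm v).
  { intros t s. exact (op_norm_le _ _ (G_linear t s) (Hgreen t s)). }
  assert (Hstrict : forall t s v, t < s ->
    norm (T t s (minus v (P s v))) <= D * exp (- rho * (s - t)) * norm v).
  { intros t s v Hts. specialize (HG t s v). unfold green in HG.
    destruct (Rle_dec s t); [lra|].
    rewrite (norm_opp (V := X)), Rabs_left in HG by lra.
    replace (s - t) with (- (t - s)) by ring. exact HG. }
  exists P. split; [exact P_linear|]. split; [exact HPT|]. split.
  - intros t s v Hst. specialize (HG t s v). unfold green in HG.
    destruct (Rle_dec s t); [|lra]. rewrite Rabs_pos_eq in HG by lra. exact HG.
  - (* The Green function only controls the unstable part off the diagonal; at
       [s = t] transport [v] to a slightly later time and back. *)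
    intros t s v [Hts|<-]; [now apply Hstrict|].
    rewrite (evolution_id A T T_evol).
    replace (- rho * (t - t)) with 0 by ring. rewrite exp_0, Rmult_1_r.
    apply le_epsilon. intros e He.
    (* The return trip multiplies by at most [D], so the outward trip may cost [e / D]. *)
    assert (HeD : 0 < e / D) by (apply Rdiv_lt_0_compat; lra).
    destruct (proj1 (continuous_norm (X := X) _ _)
      (evolution_continuous A T T_evol t t v) _ HeD) as [d Hd].
    set (s := t + d / 2). pose proof (cond_pos d).
    specialize (Hd s). rewrite (evolution_id A T T_evol) in Hd.
    assert (Hw : norm (T s t v) <= norm v + e / D).
    { apply Rle_trans with (norm v + norm (minus (T s t v) v)).
      - apply norm_le_plus. module_eq.
      - apply Rplus_le_compat_l, Rlt_le, Hd.
        apply Rabs_def1; unfold s, minus, plus, opp; simpl; lra. }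
    replace (minus v (P t v))
      with (T t s (minus (T s t v) (P s (T s t v)))).
    2: { rewrite (linear_minus (T t s) _ _ (T_linear t s)), HPT.
      now rewrite !(evolution_comp A T T_evol), (evolution_id A T T_evol). }
    eapply Rle_trans; [apply Hstrict; unfold s; lra|].
    apply Rle_trans with (D * 1 * (norm v + e / D)).
    + apply Rmult_le_compat; [|apply norm_ge_0| |exact Hw].
      * apply Rmult_le_pos; [lra|]. apply Rlt_le, exp_pos.
      * apply Rmult_le_compat_l; [lra|]. rewrite <- exp_0. apply exp_monotone.
        assert (0 <= rho * (s - t)); [|lra].
        apply Rmult_le_pos; unfold s; lra.
    + right. field. lra.
Qed.

Lemma inhomogeneous_shadowing (b y y' : R -> X) (e : R) :
  (forall t, continuous b t) -> (forall t, is_derive y t (y' t)) ->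
  (forall t, norm (minus (minus (y' t) (A t (y t))) (b t)) <= e) ->
  exists u, is_solution (fun t v => plus (A t v) (b t)) u /\
    forall t, norm (minus (u t) (y t)) <= 2 * e * D / rho.
Proof.
  intros Hb Hy He.
  destruct dichotomy_split as (P & HP & HPT & Hst & Hun).
  destruct dich as (HD & Hrho & _).
  destruct (inhomogeneous_solution A T A_bounded A_cont T_evol b Hb) as [u0 Hu0].
  assert (He0 : 0 <= e) by exact (Rle_trans _ _ _ (norm_ge_0 _) (He 0)).
  assert (HK : 0 <= D * e) by (apply Rmult_le_pos; lra).
  set (w := fun t => minus (u0 t) (y t) : X).
  set (w' := fun t => minus (plus (A t (u0 t)) (b t)) (y' t) : X).
  (* As [u0] solves the equation exactly, [g] is the opposite of the defect of [y]. *)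
  set (g := fun t => minus (w' t) (A t (w t)) : X).
  assert (Hg : forall t, norm (g t) <= e).
  { intros t. eapply Rle_trans; [|apply (He t)]. right.
    rewrite <- (norm_opp (V := X)). f_equal. unfold g, w', w.
    rewrite (linear_minus (A t) _ _ (A_bounded t)). module_eq. }
  set (G := fun s => T 0 s (w s)).
  assert (HG : forall s, is_derive G s (T 0 s (g s))).
  { intros s. apply (evolution_pullback_derive A T A_bounded A_cont T_evol).
    apply (is_derive_minus (V := X)); [apply Hu0|apply Hy]. }
  assert (Hdecay : forall B (v : X) r, 0 <= B -> norm v <= D * B * norm (g r) ->
    norm v <= D * e * B).
  { intros B v r HB Hv. eapply Rle_trans; [exact Hv|].
    replace (D * e * B) with (D * B * e) by ring.
    apply Rmult_le_compat_l; [|apply Hg]. apply Rmult_le_pos; lra. }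
  destruct (backward_limit_bound (fun t => T t 0) (fun s => P 0 (G s))
    (fun s => P 0 (T 0 s (g s))) (D * e) rho) as [p Hp].
  { exact HK. } { exact Hrho. } { intros t. apply T_linear. }
  { intros v. apply (evolution_id A T T_evol). }
  { intros s. exact (is_derive_linear (X := X) (P 0) G s _ (HP 0) (HG s)). }
  (* Invariance of the projections makes the vector to be bounded [T t s (P s (g s))], a stable one
     with [s <= t]. *)
  { intros t s Hts. rewrite <- HPT, (evolution_comp A T T_evol).
    apply (Hdecay _ _ s); [apply Rlt_le, exp_pos|]. now apply Hst. }
  destruct (forward_limit_bound (fun t => T t 0) (fun s => minus (G s) (P 0 (G s)))
    (fun s => minus (T 0 s (g s)) (P 0 (T 0 s (g s)))) (D * e) rho) as [q Hq].
  { exact HK. } { exact Hrho. } { intros t. apply T_linear. }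
  { intros v. apply (evolution_id A T T_evol). }
  { intros s. apply (is_derive_minus (V := X)); [apply HG|].
    exact (is_derive_linear (X := X) (P 0) G s _ (HP 0) (HG s)). }
  { intros t s Hts.
    rewrite <- HPT, <- (linear_minus (T 0 s) _ _ (T_linear 0 s)).
    rewrite (evolution_comp A T T_evol).
    apply (Hdecay _ _ s); [apply Rlt_le, exp_pos|]. now apply Hun. }
  exists (fun t => minus (u0 t) (T t 0 (plus p q))). split.
  - intros t.
    replace (plus (A t (minus (u0 t) (T t 0 (plus p q)))) (b t))
      with (minus (plus (A t (u0 t)) (b t)) (A t (T t 0 (plus p q)))).
    2: { rewrite (linear_minus (A t) _ _ (A_bounded t)). module_eq. }
    apply (is_derive_minus (V := X)); [apply Hu0|].
    apply (evolution_solves A T T_evol).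
  - intros t.
    (* The difference from [y] is [T t 0 (G t - (p + q))]; its stable and unstable parts contribute
       [D * e / rho] each. *)
    replace (2 * e * D / rho) with (D * e / rho + D * e / rho) by (field; lra).
    eapply Rle_trans; [|apply Rplus_le_compat; [apply (Hp t)|apply (Hq t)]].
    apply norm_le_plus.
    rewrite <- (linear_plus (T t 0) (T_linear t 0)).
    replace (minus (minus (u0 t) (T t 0 (plus p q))) (y t))
      with (minus (w t) (T t 0 (plus p q))) by (unfold w; module_eq).
    replace (w t) with (T t 0 (G t)).
    2: { unfold G. now rewrite (evolution_comp A T T_evol), (evolution_id A T T_evol). }
    rewrite <- (linear_minus (T t 0) _ _ (T_linear t 0)). f_equal. module_eq.
Qed.

(** The stable part of [z t] is carried from time [t - r] and the unstable part from [t + r]; with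
    [z] bounded, both are as small as desired for a suitable [r]. *)
Lemma bounded_solution_zero (z : R -> X) (M : R) :
  is_solution A z -> (forall t, norm (z t) <= M) -> forall t, z t = zero.
Proof.
  intros Hz HM t.
  destruct dichotomy_split as (P & HP & HPT & Hst & Hun).
  destruct dich as (HD & Hrho & _).
  assert (HM0 : 0 <= M) by exact (Rle_trans _ _ _ (norm_ge_0 _) (HM 0)).
  assert (Htr : forall s, T t s (z s) = z t).
  { intros s. symmetry. now apply (evolution_transports A T T_evol). }
  assert (Hfar : forall e, 0 < e -> exists r, 0 <= r /\ D * exp (- rho * r) * M <= e).
  { intros e He.
    assert (HDM : 0 <= D * M) by (apply Rmult_le_pos; lra).
    destruct (exp_decay_small rho (D * M) e Hrho HDM He) as [a Ha].
    exists (Rmax 0 (- a)). split; [apply Rmax_l|].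
    specialize (Ha (- Rmax 0 (- a))).
    replace (- rho * Rmax 0 (- a)) with (rho * - Rmax 0 (- a)) by ring.
    pose proof (Rmax_r 0 (- a)). lra. }
  assert (Hmono : forall r s, 0 <= r ->
    D * exp (- rho * r) * norm (z s) <= D * exp (- rho * r) * M).
  { intros r s Hr. apply Rmult_le_compat_l; [|apply HM].
    apply Rmult_le_pos; [lra|]. apply Rlt_le, exp_pos. }
  apply norm_le_eps. intros e He.
  destruct (Hfar (e / 2)) as (r & Hr & Hre); [lra|].
  assert (HPz : norm (P t (z t)) <= e / 2).
  { rewrite <- (Htr (t - r)), <- HPT.
    eapply Rle_trans; [apply Hst; lra|].
    replace (t - (t - r)) with r by ring.
    eapply Rle_trans; [apply Hmono|]; assumption. }
  assert (HQz : norm (minus (z t) (P t (z t))) <= e / 2).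
  { rewrite <- (Htr (t + r)), <- HPT.
    rewrite <- (linear_minus (T t (t + r)) _ _ (T_linear t (t + r))).
    eapply Rle_trans; [apply Hun; lra|].
    replace (t + r - t) with r by ring.
    eapply Rle_trans; [apply Hmono|]; assumption. }
  replace e with (e / 2 + e / 2) by lra.
  eapply Rle_trans; [|apply Rplus_le_compat; [exact HPz|exact HQz]].
  apply norm_le_plus. module_eq.
Qed.

Lemma inhomogeneous_unique (b u v : R -> X) (M : R) :
  is_solution (fun t x => plus (A t x) (b t)) u ->
  is_solution (fun t x => plus (A t x) (b t)) v ->
  (forall t, norm (minus (u t) (v t)) <= M) -> forall t, u t = v t.
Proof.
  intros Hu Hv HM t. apply minus_zero_eq.
  apply (bounded_solution_zero (fun t => minus (u t) (v t)) M); [|exact HM].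
  intros s.
  replace (A s (minus (u s) (v s)))
    with (minus (plus (A s (u s)) (b s)) (plus (A s (v s)) (b s))).
  - apply (is_derive_minus (V := X)); [apply Hu|apply Hv].
  - rewrite (linear_minus (A s) _ _ (A_bounded s)). module_eq.
Qed.

End Dichotomy.

(** * The nonlinear equation *)

Lemma pow_mult_small (q B e : R) :
  0 <= q < 1 -> 0 <= B -> 0 < e ->
  exists N, forall n, (N <= n)%nat -> q ^ n * B <= e.
Proof.
  intros Hq HB He.
  assert (HeB : 0 < e / (B + 1)) by (apply Rdiv_lt_0_compat; lra).
  destruct (pow_lt_1_zero q ltac:(rewrite Rabs_pos_eq; lra) _ HeB) as [N HN].
  exists N. intros n Hn. specialize (HN n Hn).
  assert (Hp : 0 <= q ^ n) by (apply pow_le; lra).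
  rewrite Rabs_pos_eq in HN by exact Hp.
  apply Rle_trans with (q ^ n * (B + 1)); [apply Rmult_le_compat_l; lra|].
  replace e with (e / (B + 1) * (B + 1)) by (field; lra).
  apply Rmult_le_compat_r; lra.
Qed.

Section Fixed_point.

Context {X : CompleteNormedModule R_AbsRing}.
Variables (A : R -> X -> X) (T : R -> R -> X -> X).
Hypothesis A_bounded : forall t, is_linear (A t).
Hypothesis A_cont : op_continuous A.
Hypothesis T_evol : evolution_family A T.
Variables (D rho : R).
Hypothesis dich : exponential_dichotomy T D rho.
Variable f : R -> X -> X.
Hypothesis f_cont :
  forall p : R * X, continuous (fun p : R * X => f (fst p) (snd p)) p.
Variable c : R.
Hypothesis c_ge0 : 0 <= c.
Hypothesis f_lip :
  forall t (x z : X), norm (minus (f t x) (f t z)) <= c * norm (minus x z).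
Hypothesis q_lt1 : 2 * c * D / rho < 1.
Variables (eps : R) (y y' : R -> X).
Hypothesis eps_gt0 : 0 < eps.
Hypothesis y_diff : forall t, is_derive y t (y' t).
Hypothesis y_approx :
  forall t, norm (minus (minus (y' t) (A t (y t))) (f t (y t))) <= eps.

(** Graph of the contraction: bounded distance from [y] singles out one solution of the equation
    with [w] frozen in the nonlinearity. *)
Definition frozen_solution (w u : R -> X) : Prop :=
  is_solution (fun t v => plus (A t v) (f t (w t))) u /\
  exists M, forall t, norm (minus (u t) (y t)) <= M.

(** Domain of the contraction: continuity of [w] makes the forcing continuous, and bounded distance
    keeps the defect of [y] bounded. *)
Definition admissible (w : R -> X) : Prop :=
  (forall t, continuous w t) /\ exists M, forall t, norm (minus (w t) (y t)) <= M.

(** Here [q] is the contraction ratio, [L] bounds the distance from [y] to its image, and [B] is the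
    radius with [q * B + L = B]. *)
Let q := 2 * c * D / rho.
Let L := 2 * eps * D / rho.
Let B := L / (1 - q).

Lemma forcing_continuous (w : R -> X) :
  (forall t, continuous w t) -> forall t, continuous (fun t => f t (w t)) t.
Proof.
  intros Hw t.
  apply (continuous_comp_2 (fun t : R => t) w f t);
    [apply continuous_id|apply Hw|apply f_cont].
Qed.

Lemma frozen_solution_admissible (w u : R -> X) :
  frozen_solution w u -> admissible u.
Proof.
  intros [Hu HM]. split; [|exact HM].
  intros t. exact (is_derive_continuous (X := X) u t _ (Hu t)).
Qed.

Lemma y_admissible : admissible y.
Proof.
  split.
  - intros t. exact (is_derive_continuous (X := X) y t _ (y_diff t)).
  - exists 0. intros t. right. apply (norm_minus_self (X := X)).
Qed.

Lemma frozen_solution_exists (w : R -> X) :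
  admissible w -> exists u, frozen_solution w u.
Proof.
  intros [Hw [M HM]].
  (* Replacing [y] by [w] inside [f] adds at most [c * M] to the defect. *)
  destruct (inhomogeneous_shadowing A T A_bounded A_cont T_evol D rho dich
    (fun t => f t (w t)) y y' (eps + c * M)) as [u [Hu HuM]].
  - now apply forcing_continuous.
  - exact y_diff.
  - intros t.
    apply Rle_trans with (eps + norm (minus (f t (y t)) (f t (w t)))).
    + eapply Rle_trans; [|apply Rplus_le_compat_r, (y_approx t)].
      apply norm_le_plus. module_eq.
    + apply Rplus_le_compat_l. eapply Rle_trans; [apply f_lip|].
      apply Rmult_le_compat_l; [exact c_ge0|].
      apply (norm_minus_le_sym (X := X)), HM.
  - exists u. split; [exact Hu|]. now eexists.
Qed.

(** Shadowing yields some solution near [v]; it stays at bounded distance from [u], so uniqueness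
    identifies the two. *)
Lemma frozen_solution_shadows (w u v v' : R -> X) (e : R) :
  admissible w -> frozen_solution w u ->
  (forall t, is_derive v t (v' t)) ->
  (exists M, forall t, norm (minus (v t) (y t)) <= M) ->
  (forall t, norm (minus (minus (v' t) (A t (v t))) (f t (w t))) <= e) ->
  forall t, norm (minus (u t) (v t)) <= 2 * e * D / rho.
Proof.
  intros [Hw _] [Hu [Mu HMu]] Hv [Mv HMv] He t.
  destruct (inhomogeneous_shadowing A T A_bounded A_cont T_evol D rho dich
    (fun t => f t (w t)) v v' e) as [u' [Hu' Hd]].
  - now apply forcing_continuous.
  - exact Hv.
  - exact He.
  - replace (u t) with (u' t); [apply Hd|].
    apply (inhomogeneous_unique A T A_bounded T_evol D rho dich
      (fun t => f t (w t)) u' u (2 * e * D / rho + Mv + Mu) Hu' Hu).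
    intros s.
    apply (norm_minus_trans (X := X) _ (y s) _ (2 * e * D / rho + Mv) Mu);
      [|apply (norm_minus_le_sym (X := X)), HMu|apply Rle_refl].
    apply (norm_minus_trans (X := X) _ (v s) _ (2 * e * D / rho) Mv);
      [apply Hd|apply HMv|apply Rle_refl].
Qed.

(** In the equation frozen at [w2], the curve [u1] has defect [f s (w1 s) - f s (w2 s)], of norm at
    most [c * M], so [u2] shadows it. *)
Lemma frozen_solution_contraction (w1 w2 u1 u2 : R -> X) (M : R) :
  admissible w2 -> frozen_solution w1 u1 -> frozen_solution w2 u2 ->
  (forall t, norm (minus (w1 t) (w2 t)) <= M) ->
  forall t, norm (minus (u1 t) (u2 t)) <= q * M.
Proof.
  intros Hw2 [Hu1 HM1] Hu2 HM t.
  rewrite (norm_minus_sym (X := X)). replace (q * M) with (2 * (c * M) * D / rho).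
  2: { unfold q, Rdiv. ring. }
  apply (frozen_solution_shadows w2 u2 u1 _ (c * M) Hw2 Hu2 Hu1 HM1).
  intros s.
  replace (minus (minus (plus (A s (u1 s)) (f s (w1 s))) (A s (u1 s))) (f s (w2 s)))
    with (minus (f s (w1 s)) (f s (w2 s))) by module_eq.
  eapply Rle_trans; [apply f_lip|].
  apply Rmult_le_compat_l; [exact c_ge0|apply HM].
Qed.

Lemma frozen_solution_near (u : R -> X) :
  frozen_solution y u -> forall t, norm (minus (u t) (y t)) <= L.
Proof.
  intros Hu.
  apply (frozen_solution_shadows y u y y' eps y_admissible Hu y_diff);
    [apply y_admissible|exact y_approx].
Qed.

Lemma contraction_constants : 0 <= q < 1 /\ 0 <= B /\ q * B + L = B.
Proof.
  destruct dich as (HD & Hrho & _).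
  assert (Hr : 0 < / rho) by now apply Rinv_0_lt_compat.
  assert (Hq : 0 <= q).
  { unfold q, Rdiv. repeat apply Rmult_le_pos; lra. }
  assert (HL : 0 <= L).
  { unfold L, Rdiv. repeat apply Rmult_le_pos; lra. }
  assert (Hq1 : q < 1) by exact q_lt1.
  split; [lra|]. split.
  - apply Rmult_le_pos; [exact HL|]. apply Rlt_le, Rinv_0_lt_compat. lra.
  - unfold B. field. lra.
Qed.

Lemma near_solution_exists :
  exists x, is_solution (fun t v => plus (A t v) (f t v)) x /\
    forall t, norm (minus (x t) (y t)) <= B.
Proof.
  destruct contraction_constants as (Hq & HB & HqB).
  destruct (functional_choice (fun w u => admissible w -> frozen_solution w u))
    as [Phi HPhi].
  { intros w. destruct (Classical_Prop.classic (admissible w)) as [Hw|Hw].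
    - destruct (frozen_solution_exists w Hw) as [u Hu]. now exists u.
    (* Arbitrary value outside the domain, so that choice yields a total map. *)
    - exists w. tauto. }
  set (u := fun n => Nat.iter n Phi y).
  assert (Hadm : forall n, admissible (u n)).
  { induction n as [|n IH]; [exact y_admissible|].
    exact (frozen_solution_admissible _ _ (HPhi _ IH)). }
  assert (Hsol : forall n, frozen_solution (u n) (u (S n))).
  { intros n. apply (HPhi (u n) (Hadm n)). }
  assert (Hnear : forall n t, norm (minus (u n t) (y t)) <= B).
  { induction n as [|n IH]; intros t.
    - change (norm (minus (y t) (y t)) <= B). now rewrite (norm_minus_self (X := X)).
    (* Compare with [u 1], the image of [y]: it lies within [q * B] of [u (S n)] and within [L] of
       [y]. *)
    - rewrite <- HqB.
      apply (norm_minus_trans (X := X) _ (u 1%nat t) _ (q * B) L); [| |apply Rle_refl].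
      + apply (frozen_solution_contraction (u n) (u O) _ _ B
          (Hadm O) (Hsol n) (Hsol O)), IH.
      + apply frozen_solution_near, (Hsol O). }
  (* Both terms are [n]-fold images, of [u k] and of [y], which are within [B] of each other. *)
  assert (Hcauchy : forall n k t, norm (minus (u (n + k)%nat t) (u n t)) <= q ^ n * B).
  { induction n as [|n IH]; intros k t.
    - rewrite Rmult_1_l. apply Hnear.
    - simpl. rewrite Rmult_assoc.
      apply (frozen_solution_contraction (u (n + k)%nat) (u n) _ _ _
        (Hadm n) (Hsol (n + k)%nat) (Hsol n)), IH. }
  (* Completeness is that of the function space with its uniform structure, so the limit is uniform
     in time. *)
  destruct (proj1 (filterlim_locally_cauchy (F := eventually)
    (U := fct_CompleteSpace (T := R) (U := X)) u)) as [x Hx].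
  { intros e.
    destruct (pow_mult_small q B (e / 4) Hq HB) as [N HN].
    { pose proof (cond_pos e). lra. }
    exists (fun n => (N <= n)%nat). split; [now exists N|].
    intros n m Hn Hm t. apply (norm_compat1 (V := X)).
    pose proof (cond_pos e). specialize (HN N (le_n N)).
    pose proof (Hcauchy N (n - N)%nat t) as H1.
    pose proof (Hcauchy N (m - N)%nat t) as H2.
    replace (N + (n - N))%nat with n in H1 by lia.
    replace (N + (m - N))%nat with m in H2 by lia.
    apply (norm_minus_le_sym (X := X)) in H1.
    apply Rle_lt_trans with (e / 2); [|lra].
    apply (norm_minus_trans (X := X) _ _ _ _ _ _ H2 H1). lra. }
  assert (Hlim : forall e, 0 < e ->
    exists N, forall n t, (N <= n)%nat -> norm (minus (u n t) (x t)) <= e).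
  { intros e He.
    (* Balls of the uniform structure compare with the norm up to [norm_factor]. *)
    assert (Hn := norm_factor_gt_0 (V := X)).
    assert (Hef : 0 < e / norm_factor (V := X)) by now apply Rdiv_lt_0_compat.
    destruct (proj1 (filterlim_locally (F := eventually)
      (U := fct_UniformSpace R X) u x) Hx (mkposreal _ Hef)) as [N HN].
    exists N. intros n t Hn'. specialize (HN n Hn' t).
    apply (norm_compat2 (V := X)) in HN. simpl in HN.
    replace (norm_factor * (e / norm_factor)) with e in HN by (field; lra).
    now apply Rlt_le. }
  assert (Hx_near : forall t, norm (minus (x t) (y t)) <= B).
  { intros t. apply le_epsilon. intros e He. destruct (Hlim e He) as [N HN].
    apply (norm_minus_trans (X := X) _ (u N t) _ e B).
    - apply (norm_minus_le_sym (X := X)), HN, le_n.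
    - apply Hnear.
    - lra. }
  assert (Hx_cont : forall t, continuous x t).
  { intros t. apply (continuous_norm (X := X)). intros e He.
    destruct (Hlim (e / 4)) as [N HN]; [lra|].
    assert (He4 : 0 < e / 4) by lra.
    generalize (proj1 (continuous_norm (X := X) _ _) (proj1 (Hadm N) t) _ He4).
    apply filter_imp. intros s Hs.
    apply Rle_lt_trans with (e / 4 + (e / 4 + e / 4)); [|lra].
    eapply (norm_minus_trans (X := X));
      [apply (norm_minus_le_sym (X := X)), (HN N), le_n| |].
    - eapply (norm_minus_trans (X := X));
        [apply Rlt_le, Hs|apply (HN N), le_n|apply Rle_refl].
    - apply Rle_refl. }
  assert (Hx_adm : admissible x) by (split; [exact Hx_cont|now exists B]).
  (* The contraction puts [Phi x] within [q * (e / 2)] of [u (S N)], itself within [e / 2] of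
     [x]. *)
  assert (Hfix : Phi x = x).
  { apply functional_extensionality. intros t. apply norm_le_eps. intros e He.
    destruct (Hlim (e / 2)) as [N HN]; [lra|].
    assert (H : norm (minus (Phi x t) (u (S N) t)) <= q * (e / 2)).
    { apply (frozen_solution_contraction x (u N) _ _ _ (Hadm N) (HPhi x Hx_adm)
        (Hsol N)).
      intros s. rewrite (norm_minus_sym (X := X)). now apply HN. }
    apply (norm_minus_trans (X := X) _ _ _ _ (e / 2) _ H).
    - apply HN, le_S, le_n.
    - assert (q * (e / 2) <= 1 * (e / 2)) by (apply Rmult_le_compat_r; lra). lra. }
  exists x. split; [|exact Hx_near].
  destruct (HPhi x Hx_adm) as [H _]. rewrite Hfix in H. exact H.
Qed.

Lemma near_solution_unique (x z : R -> X) :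
  is_solution (fun t v => plus (A t v) (f t v)) x ->
  is_solution (fun t v => plus (A t v) (f t v)) z ->
  (forall t, norm (minus (x t) (y t)) <= B) ->
  (forall t, norm (minus (z t) (y t)) <= B) -> x = z.
Proof.
  intros Hx Hz HxB HzB.
  destruct contraction_constants as (Hq & HB & _).
  assert (Fx : frozen_solution x x) by (split; [exact Hx|now exists B]).
  assert (Fz : frozen_solution z z) by (split; [exact Hz|now exists B]).
  assert (H : forall n t, norm (minus (x t) (z t)) <= q ^ n * (2 * B)).
  { induction n as [|n IH]; intros t.
    - apply (norm_minus_trans (X := X) _ (y t) _ B B).
      + apply HxB.
      + apply (norm_minus_le_sym (X := X)), HzB.
      + simpl. lra.
    - simpl. rewrite Rmult_assoc.
      apply (frozen_solution_contraction x z x z _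
        (frozen_solution_admissible z z Fz) Fx Fz), IH. }
  apply functional_extensionality. intros t. apply norm_le_eps. intros e He.
  destruct (pow_mult_small q (2 * B) e Hq ltac:(lra) He) as [N HN].
  eapply Rle_trans; [apply (H N)|apply HN, le_n].
Qed.

End Fixed_point.

(** * Supremum distance and conclusion for each parameter *)

Lemma sup_dist_le {X : NormedModule R_AbsRing} (x y : R -> X) (K : R) :
  Rbar_le (sup_dist x y) K <-> forall t, norm (minus (x t) (y t)) <= K.
Proof.
  destruct (Lub_Rbar_correct (fun r => exists t, r = norm (minus (x t) (y t))))
    as [Hub Hlub].
  split.
  - intros H t. apply (Rbar_le_trans (norm (minus (x t) (y t))) (sup_dist x y) K);
      [|exact H].
    apply Hub. now exists t.
  - intros H. apply Hlub. intros r [t ->]. apply H.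
Qed.
Theorem corollary1
  (X Y : CompleteNormedModule R_AbsRing)
  (Sigma : Y -> Prop) (Sigma_open : open Sigma)
  (A : R -> X -> X) (A_bounded : forall t : R, is_linear (A t))
  (A_cont : op_continuous A)
  (T : R -> R -> X -> X) (T_evol : evolution_family A T)
  (f : Y -> R -> X -> X)
  (f_cont : forall lam : Y, Sigma lam -> forall p : R * X,
      continuous (fun p : R * X => f lam (fst p) (snd p)) p)
  (D rho : R) (dich : exponential_dichotomy T D rho)
  (c : R) (c_ge0 : 0 <= c)
  (f_lip : forall (t : R) (lam : Y), Sigma lam -> forall x y : X,
      norm (minus (f lam t x) (f lam t y)) <= c * norm (minus x y))
  (q_lt1 : 2 * c * D / rho < 1)
  (eps : R) (eps_gt0 : 0 < eps)
  (y y' : Y -> R -> X)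
  (y_diff : forall lam : Y, Sigma lam ->
      forall t : R, is_derive (y lam) t (y' lam t))
  (y_approx : forall lam : Y, Sigma lam -> forall t : R,
      norm (minus (minus (y' lam t) (A t (y lam t))) (f lam t (y lam t))) <= eps) :
  forall lam : Y, Sigma lam ->
    exists! x : R -> X,
      is_solution (fun t v => plus (A t v) (f lam t v)) x /\
      Rbar_le (sup_dist x (y lam))
        ((2 * eps * D / rho) / (1 - 2 * c * D / rho)).
Proof.
  intros lam Hlam.
  destruct (near_solution_exists A T A_bounded A_cont T_evol D rho dich (f lam)
    (f_cont lam Hlam) c c_ge0 (fun t => f_lip t lam Hlam) q_lt1 eps (y lam) (y' lam)
    eps_gt0 (y_diff lam Hlam) (y_approx lam Hlam)) as [x [Hx Hnear]].
  exists x. split.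
  - split; [exact Hx|]. exact (proj2 (sup_dist_le (X := X) x (y lam) _) Hnear).
  - intros z [Hz HzB].
    pose proof (proj1 (sup_dist_le (X := X) z (y lam) _) HzB) as Hz_near.
    exact (near_solution_unique A T A_bounded A_cont T_evol D rho dich (f lam)
      (f_cont lam Hlam) c c_ge0 (fun t => f_lip t lam Hlam) q_lt1 eps (y lam)
      eps_gt0 x z Hx Hz Hnear Hz_near).
Qed.
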